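(* Let $p>1$ be a real number and let $G$ be a finitely generated group with a central element of infinite order. Then $\overline{H}^1_{(p)}(G)=0$.
   Context: $L^p(G)$ is the Banach space of functions $\alpha:G\to\mathbb{C}$ with $\|\alpha\|_p=(\sum_{x\in G}|\alpha(x)|^p)^{1/p}<\infty$. It is a right $G$-module via right translation $\alpha\mapsto\alpha_g$, where $\alpha_g(x)=\alpha(xg^{-1})$. A $1$-cocycle with values in $L^p(G)$ is a map $\delta:G\to L^p(G)$ with $\delta(gh)=(\delta(g))_h+\delta(h)$ for all $g,h\in G$; a $1$-coboundary is a map of the form $\delta(g)=\alpha_g-\alpha$ for some $\alpha\in L^p(G)$. Let $Z^1(G,L^p(G))$ and $B^1(G,L^p(G))$ be the vector spaces of $1$-cocycles and $1$-coboundaries. $Z^1(G,L^p(G))$ is given the topology in which $\delta_n\to\delta$ iff $\delta_n(g)\to\delta(g)$ in $L^p(G)$ for every $g\in G$ (pointwise norm convergence). The first reduced $L^p$-cohomology space is $\overline{H}^1_{(p)}(G)=Z^1(G,L^p(G))/\overline{B^1(G,L^p(G))}$. Equivalent description used in the paper: fix a finite symmetric generating set $S$ of $G$ (i.e. $S=S^{-1}$), for a function $\beta:G\to\mathbb{C}$ and $g\in G$ write $(\beta*(g-1))(x)=\beta(xg^{-1})-\beta(x)$, and let $D^p(G)$ be the space of functions $\beta:G\to\mathbb{C}$ with $\beta*(g-1)\in L^p(G)$ for all $g\in S$, a Banach space under $\|\beta\|_{D^p(G)}=(\sum_{g\in S}\|\beta*(g-1)\|_p^p+|\beta(e)|^p)^{1/p}$,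 where $e$ is the identity of $G$. Sending $\beta$ to the cocycle $g\mapsto\beta*(g-1)$ identifies $\overline{H}^1_{(p)}(G)$ with $D^p(G)/\overline{L^p(G)\oplus\mathbb{C}}$, where $\mathbb{C}$ denotes the constant functions and the closure is taken in $D^p(G)$. *)

(* Defs.v *)
From HB Require Import structures.
From mathcomp Require Import all_boot all_order all_algebra complex ring.
From mathcomp Require Import all_classical all_reals all_analysis.

Set Implicit Arguments.
Unset Strict Implicit.
Unset Printing Implicit Defensive.

Import Order.TTheory GRing.Theory Num.Theory.
Import numFieldTopology.Exports numFieldNormedType.Exports.
Import ComplexField.Normc.

Local Open Scope classical_set_scope.
Local Open Scope ring_scope.

Section group_notions.
Variable G : groupType.
Local Open Scope group_scope.

Definition finitely_generated :=
  exists S : seq G, forall H : {pred G},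
    group_closed H -> {subset S <= H} -> forall g, g \in H.

Definition central (z : G) := forall g : G, commute z g.

Definition infinite_order (z : G) := forall n : nat, (0 < n)%N -> z ^+ n <> 1.

End group_notions.

Section esum_extra.
Variables (R : realType) (T : choiceType).
Local Open Scope ereal_scope.

Lemma le_esumZ (c : R) (f : T -> \bar R) : (0 <= c)%R -> (forall x, 0 <= f x) ->
  \esum_(x in [set: T]) (c%:E * f x) <= c%:E * \esum_(x in [set: T]) f x.
Proof.
move=> c0 f0; apply: ge_ereal_sup => /= _ [X [finX _] <-].
rewrite -ge0_mule_fsumr//; apply: lee_wpmul2l; first by rewrite lee_fin.
by apply: ereal_sup_ubound; exists X.
Qed.

Lemma esumZ (c : R) (f : T -> \bar R) : (0 <= c)%R -> (forall x, 0 <= f x) ->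
  \esum_(x in [set: T]) (c%:E * f x) = c%:E * \esum_(x in [set: T]) f x.
Proof.
move=> cge0 f0; apply/eqP; rewrite eq_le le_esumZ//=.
have [->|cn0] := eqVneq c 0%R.
  by rewrite mul0e; apply: esum_ge0 => x _; rewrite mul0e.
have {cn0}c0 : (0 < c)%R by rewrite lt_neqAle eq_sym cn0.
rewrite muleC -lee_pdivlMr// muleC.
have h x : f x = c^-1%:E * (c%:E * f x).
  by rewrite muleA -EFinM mulVf ?gt_eqF// mul1e.
under eq_esum do rewrite h.
apply: le_esumZ; first by rewrite invr_ge0 ltW.
by move=> x; rewrite mule_ge0// lee_fin ltW.
Qed.

End esum_extra.

Lemma ler_convex_powR (R : realType) (p t x y : R) : 1 <= p -> 0 <= t <= 1 ->
  0 <= x -> 0 <= y ->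
  (t * x + (1 - t) * y) `^ p <= t * x `^ p + (1 - t) * y `^ p.
Proof.
move=> p1 /andP[t0 t1] x0 y0.
by apply: (convex_powR p1 (Itv01 t0 t1)); rewrite inE/= in_itv/= ?x0 ?y0.
Qed.

Lemma initial_cvgE (S : choiceType) (T : topologicalType) (f : S -> T)
    (F : set_system S) (s : S) : Filter F ->
  F --> (s : initial_topology f) <-> f @ F --> f s.
Proof.
move=> FF; split=> [Fs|Ffs].
  by apply: (cvg_trans (cvg_app f Fs)); exact: initial_continuous.
move=> U; rewrite nbhsE => -[_ [[B oB <-] Bs] BU].
apply: filterS BU _; apply: Ffs; exact: open_nbhs_nbhs.
Qed.

Section lp_functions.
Variables (R : realType) (p : R) (p1 : 1 <= p) (G : groupType).
Implicit Types (a b : G -> R[i]^o).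

Definition lpsum a : \bar R :=
  \esum_(x in [set: G]) ((normc (a x : R[i])) `^ p)%:E.

Definition lpnorm a : R := (fine (lpsum a)) `^ p^-1.

(* p1 is recorded in the predicate so that the closure properties, hence the
   module structure, can be inferred from it. *)
Definition lp_pred of 1 <= p : {pred G -> R[i]^o} :=
  fun a => `[< (lpsum a < +oo)%E >].

Definition rtranslate a (g : G) : G -> R[i]^o := fun x => a (x * g^-1)%g.

Let p0 : 0 < p. Proof. exact: lt_le_trans p1. Qed.

Lemma normc_ge0 (z : R[i]) : 0 <= normc z.
Proof. by case: z => x y /=; rewrite sqrtr_ge0. Qed.

Lemma lpsum_ge0 a : (0 <= lpsum a)%E.
Proof. by apply: esum_ge0 => x _; rewrite lee_fin powR_ge0. Qed.

Lemma lpnorm_ge0 a : 0 <= lpnorm a.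
Proof. exact: powR_ge0. Qed.

Lemma lpsum_norm a : (lpsum a < +oo)%E -> lpsum a = ((lpnorm a) `^ p)%:E.
Proof.
move=> afin; rewrite /lpnorm -powRrM mulVf ?gt_eqF// powRr1 ?fine_ge0 ?lpsum_ge0//.
by rewrite fineK// ge0_fin_numE ?lpsum_ge0.
Qed.

Lemma lpnorm_le a (A : R) : 0 <= A -> (lpsum a <= (A `^ p)%:E)%E -> lpnorm a <= A.
Proof.
move=> A0 aA; rewrite /lpnorm -[leRHS](powRr1 A0) -(mulfV (lt0r_neq0 p0)).
rewrite powRrM ge0_ler_powR ?invr_ge0 ?(ltW p0) ?nnegrE ?powR_ge0 ?fine_ge0 ?lpsum_ge0//.
rewrite -lee_fin fineK// ge0_fin_numE ?lpsum_ge0//.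
by apply: le_lt_trans aA _; rewrite ltry.
Qed.

Lemma lpsumD_le a b (A B : R) : 0 < A -> 0 < B ->
  (lpsum a <= (A `^ p)%:E)%E -> (lpsum b <= (B `^ p)%:E)%E ->
  (lpsum (a + b)%R <= ((A + B) `^ p)%:E)%E.
Proof.
move=> A0 B0 aA bB; have AB0 : 0 < A + B by rewrite addr_gt0.
pose t := A / (A + B).
have t01 : 0 <= t <= 1.
  by rewrite /t divr_ge0 ?(ltW A0) ?(ltW AB0)//= ler_pdivrMr// mul1r lerDl ltW.
have t1E : 1 - t = B / (A + B).
  by rewrite /t; field; rewrite gt_eqF.
pose K1 := (A + B) `^ p * t * (A `^ p)^-1.
pose K2 := (A + B) `^ p * (1 - t) * (B `^ p)^-1.
have tt0 : 0 <= t by case/andP: t01.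
have tt1 : 0 <= 1 - t by rewrite subr_ge0; case/andP: t01.
have K1ge0 : 0 <= K1 by do 2 (apply: mulr_ge0; rewrite ?invr_ge0 ?powR_ge0//).
have K2ge0 : 0 <= K2 by do 2 (apply: mulr_ge0; rewrite ?invr_ge0 ?powR_ge0//).
have pw x : normc ((a + b) x : R[i]) `^ p <=
    K1 * normc (a x : R[i]) `^ p + K2 * normc (b x : R[i]) `^ p.
  set u := normc (a x : R[i]); set v := normc (b x : R[i]).
  have u0 : 0 <= u by exact: normc_ge0.
  have v0 : 0 <= v by exact: normc_ge0.
  apply: (@le_trans _ _ ((u + v) `^ p)).
    rewrite ge0_ler_powR ?(ltW p0) ?nnegrE ?normc_ge0 ?addr_ge0//.
    exact: le_normcD.
  have -> : u + v = (A + B) * (t * (u / A) + (1 - t) * (v / B)).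
    by rewrite t1E /t; field; rewrite !gt_eqF.
  have uA0 : 0 <= u / A by rewrite divr_ge0// ltW.
  have vB0 : 0 <= v / B by rewrite divr_ge0// ltW.
  rewrite powRM ?(ltW AB0)//; last by rewrite addr_ge0// mulr_ge0.
  have dv w C : 0 <= w -> 0 < C -> (w / C) `^ p = w `^ p / C `^ p.
    by move=> w0 C0; rewrite powRM ?invr_ge0 ?(ltW C0)//
      -(powR_inv1 (ltW C0)) -powRrM mulN1r powRN.
  have -> : K1 * u `^ p + K2 * v `^ p =
      (A + B) `^ p * (t * (u / A) `^ p + (1 - t) * (v / B) `^ p).
    by rewrite !dv// /K1 /K2; ring.
  by rewrite ler_wpM2l ?powR_ge0// ler_convex_powR.
apply: (@le_trans _ _ (\esum_(x in [set: G])
   ((K1%:E * (normc (a x : R[i]) `^ p)%:E) + K2%:E * (normc (b x : R[i]) `^ p)%:E)%E)).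
  by apply: le_esum => x _; rewrite -!EFinM -EFinD lee_fin.
have n0 (c : G -> R[i]^o) x : (0 <= (normc (c x : R[i]) `^ p)%:E)%E.
  by rewrite lee_fin powR_ge0.
rewrite esumD; [|by move=> x _; rewrite mule_ge0..].
rewrite !esumZ//.
apply: (@le_trans _ _ (K1%:E * (A `^ p)%:E + K2%:E * (B `^ p)%:E)%E).
  by rewrite leeD// lee_wpmul2l.
rewrite -!EFinM -EFinD lee_fin /K1 /K2 !divfK ?gt_eqF ?powR_gt0//.
by rewrite -mulrDr subrKC mulr1.
Qed.

Lemma lpsumD_fin a b :
  (lpsum a < +oo)%E -> (lpsum b < +oo)%E -> (lpsum (a + b)%R < +oo)%E.
Proof.
move=> afin bfin.
have le c : (lpsum c < +oo)%E -> (lpsum c <= ((lpnorm c + 1) `^ p)%:E)%E.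
  move=> cfin; rewrite lpsum_norm// lee_fin.
  by rewrite ge0_ler_powR ?(ltW p0) ?nnegrE ?lerDl ?addr_ge0 ?lpnorm_ge0.
have N0 c : 0 < lpnorm c + 1 by rewrite ltr_wpDl ?lpnorm_ge0.
exact: le_lt_trans (lpsumD_le (N0 a) (N0 b) (le _ afin) (le _ bfin)) (ltry _).
Qed.

Lemma ler_lpnormD a b : (lpsum a < +oo)%E -> (lpsum b < +oo)%E ->
  lpnorm (a + b) <= lpnorm a + lpnorm b.
Proof.
move=> afin bfin; apply/ler_addgt0Pr => e e0.
have e20 : 0 < e / 2 by rewrite divr_gt0.
have -> : lpnorm a + lpnorm b + e = (lpnorm a + e / 2) + (lpnorm b + e / 2).
  by rewrite addrACA -splitr.
have le c : (lpsum c < +oo)%E -> (lpsum c <= ((lpnorm c + e / 2) `^ p)%:E)%E.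
  move=> cfin; rewrite lpsum_norm// lee_fin.
  by rewrite ge0_ler_powR ?(ltW p0) ?nnegrE ?lerDl ?addr_ge0 ?lpnorm_ge0 ?ltW.
apply: lpnorm_le; first by rewrite !addr_ge0 ?lpnorm_ge0 ?ltW.
have N0 c : 0 < lpnorm c + e / 2 by rewrite ltr_wpDl ?lpnorm_ge0.
exact: (lpsumD_le (N0 a) (N0 b) (le _ afin) (le _ bfin)).
Qed.

Lemma lpsumZ (l : R[i]) a : lpsum (l *: a) = ((normc l `^ p)%:E * lpsum a)%E.
Proof.
rewrite -esumZ ?powR_ge0//; last by move=> x; rewrite lee_fin powR_ge0.
by apply: eq_esum => x _; rewrite -EFinM -powRM ?normc_ge0// -normcM.
Qed.

Lemma lpnormZ (l : R[i]) a : (lpsum a < +oo)%E ->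
  lpnorm (l *: a) = normc l * lpnorm a.
Proof.
move=> afin; rewrite /lpnorm lpsumZ fineM//; last first.
  by rewrite ge0_fin_numE ?lpsum_ge0.
rewrite /= powRM ?powR_ge0 ?fine_ge0 ?lpsum_ge0//.
by rewrite -powRrM mulfV ?gt_eqF// powRr1 ?normc_ge0.
Qed.

Lemma lpsum0 : lpsum 0 = 0%E.
Proof. by apply: esum1 => x _; rewrite normc0 powR0 ?gt_eqF. Qed.

Lemma lpnorm_eq0 a : (lpsum a < +oo)%E -> lpnorm a = 0 -> a = 0.
Proof.
move=> afin a0; apply/funext => x; apply: eq0_normc.
have : ((normc (a x : R[i]) `^ p)%:E <= lpsum a)%E.
  apply: esum_ge; exists [set x]; first by split=> //; exact: finite_set1.
  by rewrite fsbig_set1.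
rewrite lpsum_norm// a0 powR0 ?gt_eqF// lee_fin => h.
have /eqP : normc (a x : R[i]) `^ p = 0.
  by apply/eqP; rewrite eq_le h powR_ge0.
by rewrite powR_eq0 => /andP[/eqP].
Qed.

Lemma lpsum_rtranslate a g : lpsum (rtranslate a g) = lpsum a.
Proof.
rewrite [RHS](reindex_esum setT setT (fun x => x * g^-1)%g)//.
split=> //; first by move=> x y _ _; exact: mulIg.
by move=> x _; exists (x * g)%g => //; rewrite mulgK.
Qed.

End lp_functions.

Section lp_closed.
Variables (R : realType) (p : R) (p1 : 1 <= p) (G : groupType).

Lemma lp_submod_closed : submod_closed (@lp_pred R p G p1).
Proof.
split=> [|l a b /asboolP afin /asboolP bfin]; apply/asboolP.
  by rewrite lpsum0.
apply: lpsumD_fin => //; rewrite lpsumZ//.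
by rewrite lte_mul_pinfty ?lee_fin ?powR_ge0.
Qed.

HB.instance Definition _ :=
  GRing.isSubmodClosed.Build R[i] (G -> R[i]^o) (@lp_pred R p G p1)
    lp_submod_closed.

End lp_closed.

(* L^p(G), with real p >= 1, as a normed space over the complex numbers R[i];
   as for any normedModType over R[i], the norm is the R[i]-valued embedding
   of a real number. *)
Record Lp (R : realType) (p : R) (p1 : 1 <= p) (G : groupType) := MkLp {
  lp_val :> G -> R[i]^o;
  lp_valP : lp_val \in lp_pred p1
}.

Section lp_space.
Variables (R : realType) (p : R) (p1 : 1 <= p) (G : groupType).
Local Notation Lp := (Lp p1 G).

HB.instance Definition _ := [isSub of Lp for @lp_val R p p1 G].
HB.instance Definition _ := [Choice of Lp by <:].
HB.instance Definition _ := [SubChoice_isSubLmodule of Lp by <:].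

Lemma lp_fin (a : Lp) : (lpsum p a < +oo)%E.
Proof. exact: asboolW (lp_valP a). Qed.

Local Notation norm := (fun a : Lp => (lpnorm p a)%:C%C).

Fact lp_normD (a b : Lp) : norm (a + b) <= norm a + norm b.
Proof. by rewrite -rmorphD lecR; apply: ler_lpnormD; rewrite ?lp_fin. Qed.

Fact lp_normZ (l : R[i]) (a : Lp) : norm (l *: a) = `|l| * norm a.
Proof. by rewrite /= lpnormZ ?lp_fin// rmorphM. Qed.

Fact lp_norm0_eq0 (a : Lp) : norm a = 0 -> a = 0.
Proof.
move=> [a0].
by apply: val_inj; apply: (lpnorm_eq0 p1) a0; exact: lp_fin.
Qed.

HB.instance Definition _ := Lmodule_isNormed.Build R[i] Lp
  lp_normD lp_normZ lp_norm0_eq0.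

Lemma lp_normE (a : Lp) : `|a| = (lpnorm p a)%:C%C.
Proof. by []. Qed.

Fact rtrans_subproof (a : Lp) (g : G) : rtranslate a g \in lp_pred p1.
Proof. by apply/asboolP; rewrite lpsum_rtranslate lp_fin. Qed.

Definition rtrans (a : Lp) (g : G) : Lp := MkLp (rtrans_subproof a g).

Lemma rtransE a g x : rtrans a g x = a (x * g^-1)%g.
Proof. by []. Qed.

Lemma rtransM a g h : rtrans a (g * h)%g = rtrans (rtrans a g) h.
Proof. by apply/val_inj/funext => x; rewrite /= /rtranslate invgM mulgA. Qed.

Lemma rtransD g a b : rtrans (a + b) g = rtrans a g + rtrans b g.
Proof. exact/val_inj/funext. Qed.

Lemma rtransZ g (l : R[i]) a : rtrans (l *: a) g = l *: rtrans a g.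
Proof. exact/val_inj/funext. Qed.

Lemma rtransB g a b : rtrans (a - b) g = rtrans a g - rtrans b g.
Proof. exact/val_inj/funext. Qed.

Lemma rtrans0 g : rtrans 0 g = 0.
Proof. exact/val_inj/funext. Qed.

Definition cocycle_pred : {pred G -> Lp} := fun d =>
  `[< forall g h : G, d (g * h)%g = rtrans (d g) h + d h >].

Lemma cocycle_submod_closed : submod_closed cocycle_pred.
Proof.
split=> [|l d e /asboolP dP /asboolP eP]; apply/asboolP => g h.
  by rewrite /= rtrans0 addr0.
rewrite -![(l *: d + e) _]/(l *: d _ + e _) dP eP rtransD rtransZ scalerDr.
by rewrite addrACA.
Qed.

HB.instance Definition _ :=
  GRing.isSubmodClosed.Build R[i] (G -> Lp) cocycle_pred cocycle_submod_closed.

End lp_space.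

(* Z^1(G, L^p(G)), for the right action rtrans of G on L^p(G) *)
Record cocycle (R : realType) (p : R) (p1 : 1 <= p) (G : groupType) := MkCocycle {
  cocycle_val :> G -> Lp p1 G;
  cocycle_valP : cocycle_val \in @cocycle_pred R p p1 G
}.

Section reduced_cohomology.
Variables (R : realType) (p : R) (p1 : 1 <= p) (G : groupType).
Local Notation Lp := (Lp p1 G).
Local Notation cocycle := (cocycle p1 G).

HB.instance Definition _ := [isSub of cocycle for @cocycle_val R p p1 G].
HB.instance Definition _ := [Choice of cocycle by <:].
HB.instance Definition _ := [SubChoice_isSubLmodule of cocycle by <:].

HB.instance Definition _ := Topological.copy cocycle
  (initial_topology (fun d : cocycle => (d : {ptws G -> Lp}))).

(* The topology of Z^1 is that of pointwise norm convergence. *)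
Lemma cocycle_cvgE (F : set_system cocycle) (d : cocycle) : Filter F ->
  F --> d <-> forall g : G, (fun e : cocycle => e g) @ F --> d g.
Proof.
move=> FF; apply: (iff_trans (@initial_cvgE _ _ _ F d FF)).
have FG : Filter ((fun e : cocycle => (e : {ptws G -> Lp})) @ F).
  exact: fmap_filter.
apply: (iff_trans (@cvg_sup _ _ _ _ _ FG)).
by split=> Fd g; have := Fd g; [move/(initial_cvgE _ _ FG)|
  move=> ?; apply/(initial_cvgE _ _ FG)].
Qed.

Lemma cocycleP (d : cocycle) (g h : G) : d (g * h)%g = rtrans (d g) h + d h.
Proof. exact: (asboolW (cocycle_valP d)). Qed.

Fact coboundary_subproof (a : Lp) : (fun g => rtrans a g - a) \in @cocycle_pred R p p1 G.
Proof.
apply/asboolP => g h; rewrite rtransM rtransB.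
by rewrite addrA subrK.
Qed.

Definition coboundary (a : Lp) : cocycle := MkCocycle (coboundary_subproof a).

(* B^1(G, L^p(G)) *)
Definition coboundaries : set cocycle := range coboundary.

Definition closed_coboundaries : {pred cocycle} :=
  fun d => `[< closure coboundaries d >].

Lemma coboundaryB a b : coboundary (a - b) = coboundary a - coboundary b.
Proof.
apply/val_inj/funext => g /=.
rewrite -[RHS]/((rtrans a g - a) - (rtrans b g - b)) rtransB !opprB.
by rewrite addrACA [RHS]addrACA [- _ - _ in RHS]addrC.
Qed.

Lemma cocycle_sub_continuous :
  continuous (fun de : cocycle * cocycle => de.1 - de.2).
Proof.
move=> [d e]; apply/cocycle_cvgE => g /=.
have ev : forall f : cocycle, (fun c : cocycle => c g) @ f --> f g.
  by move=> f; have /cocycle_cvgE := @cvg_id _ (nbhs f); exact.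
have ev1 : (fun de : cocycle * cocycle => de.1 g : Lp) @ (d, e) --> d g.
  by apply: (@cvg_comp _ _ _ fst (fun c : cocycle => c g)); [exact: cvg_fst|exact: ev].
have ev2 : (fun de : cocycle * cocycle => de.2 g : Lp) @ (d, e) --> e g.
  by apply: (@cvg_comp _ _ _ snd (fun c : cocycle => c g)); [exact: cvg_snd|exact: ev].
exact: (cvgB ev1 ev2).
Qed.

Lemma closed_coboundaries_zmod : zmod_closed closed_coboundaries.
Proof.
split=> [|d e /asboolP dB /asboolP eB]; apply/asboolP.
  apply: subset_closure; exists 0 => //.
  by rewrite -[X in coboundary X](subrr 0) coboundaryB subrr.
move=> U Ude; have [[V W] /= [dV eW] VW] := cocycle_sub_continuous (x := (d, e)) Ude.
have [_ [[a _ <-] Va]] := dB _ dV; have [_ [[b _ <-] Wb]] := eB _ eW.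
exists (coboundary a - coboundary b); split.
  by exists (a - b) => //; rewrite coboundaryB.
exact: (VW (_, _)).
Qed.

HB.instance Definition _ :=
  GRing.isZmodClosed.Build cocycle closed_coboundaries closed_coboundaries_zmod.

(* The underlying additive group of Z^1 / closure(B^1), which vanishes exactly
   when the quotient space does. *)
Definition reducedH1 := Quotient.quot closed_coboundaries.

HB.instance Definition _ := GRing.Zmodule.on reducedH1.

End reduced_cohomology.

(* Main.v *)
(** If z is central, the cocycle identity for z^k g = g z^k reads
    d(z^k)_g - d(z^k) = d(g)_{z^k} - d(g).
    Averaging over 0 <= k <= n shows that d differs from the coboundary of
    -(n+1)^-1 \sum_k d(z^k) by the ergodic average of d(g) along z. For p > 1
    these averages tend to 0 in L^p: they are contractions and the finitely
    supported functions are dense, so it is enough to average a function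
    supported at one point; its translates have disjoint supports, so the norm
    of the average is (n+1)^(1/p - 1) times that of the function. *)
Require Import Defs.
From HB Require Import structures.
From mathcomp Require Import all_boot all_order all_algebra complex.
From mathcomp Require Import all_classical all_reals all_analysis.

Import Order.TTheory GRing.Theory Num.Theory.
Local Open Scope ring_scope.
Import numFieldTopology.Exports numFieldNormedType.Exports.
Import ComplexField.Normc.

Set Implicit Arguments.
Unset Strict Implicit.

(** * Distinct powers and disjoint supports *)

Lemma infinite_order_expg_inj (G : groupType) (z : G) : infinite_order z ->
  injective (fun k : nat => (z ^+ k)%g).
Proof.
move=> zinf.
suff h m n : (m < n)%N -> (z ^+ m)%g <> (z ^+ n)%g.
  move=> m n /= mn; case: (ltngtP m n) => // lmn; first by case: (h m n).
  by case: (h n m).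
move=> mn zmn; apply: (zinf (n - m)%N); first by rewrite subn_gt0.
by rewrite expgnFr ?(ltnW mn)// zmn divgg.
Qed.

(** At each point one summand vanishes, and [0 < p] makes its p-th power vanish too (0 to the power
    0 is 1). *)
Lemma lpsumD_disjoint (R : realType) (p : R) (G : groupType) (a b : G -> R[i]^o) :
  0 < p -> (forall x, a x = 0 \/ b x = 0) ->
  lpsum p (a + b) = (lpsum p a + lpsum p b)%E.
Proof.
move=> p0 ab; rewrite /lpsum -esumD; last 2 first.
- by move=> x _; rewrite lee_fin powR_ge0.
- by move=> x _; rewrite lee_fin powR_ge0.
apply: eq_esum => x _; rewrite -EFinD; congr EFin.
rewrite -[(a + b) x]/(a x + b x).
by case: (ab x) => ->; rewrite normc0 powR0 ?gt_eqF// ?add0r ?addr0.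
Qed.

(** * Averages of translates in [Lp] *)

Section mean_ergodic.
Local Open Scope classical_set_scope.
Local Open Scope ring_scope.
Variables (R : realType) (p : R) (p1 : 1 <= p) (G : groupType).
Local Notation Lp := (Lp p1 G).
Implicit Types (a b : Lp) (z : G).

Lemma lp_cvg0P (a_ : nat -> Lp) :
  (forall e : R, 0 < e -> \forall n \near \oo, lpnorm p (a_ n) <= e) ->
  a_ @ \oo --> (0 : Lp).
Proof.
(* A positive element of [R[i]] has zero imaginary part, so real tolerances suffice. *)
move=> h; apply/cvgrPdist_le => -[e e'] /andP[/eqP/= -> e0].
near=> n; rewrite sub0r normrN lp_normE lecR.
by near: n; exact: h.
Unshelve. all: by end_near. Qed.

Lemma rtrans_sum g n (a_ : 'I_n -> Lp) :
  rtrans (\sum_(k < n) a_ k) g = \sum_(k < n) rtrans (a_ k) g.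
Proof.
apply: (big_morph (fun a : Lp => rtrans a g)); first exact: rtransD.
exact: rtrans0.
Qed.

Lemma lpnorm_rtrans a g : lpnorm p (rtrans a g) = lpnorm p a.
Proof. by rewrite /lpnorm lpsum_rtranslate. Qed.

(** Taking [n.+1] terms keeps the scalar meaningful at every index, including 0. *)
Definition ergodic_avg z n a : Lp :=
  n.+1%:R^-1 *: \sum_(k < n.+1) rtrans a (z ^+ k)%g.

Lemma ergodic_avgD z n a b :
  ergodic_avg z n (a + b) = ergodic_avg z n a + ergodic_avg z n b.
Proof.
rewrite /ergodic_avg -scalerDr -big_split/=; congr (_ *: _).
by apply: eq_bigr => k _; rewrite rtransD.
Qed.

Lemma ergodic_avg0 z n : ergodic_avg z n 0 = 0.
Proof.
by rewrite /ergodic_avg big1 ?scaler0// => k _; rewrite rtrans0.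
Qed.

Lemma norm_ergodic_avg z n a : `|ergodic_avg z n a| <= `|a|.
Proof.
rewrite normrZ normfV normr_nat ler_pdivrMl ?ltr0n//.
apply: le_trans (ler_norm_sum _ _ _) _.
rewrite (eq_bigr (fun=> `|a|)) => [|k _].
  by rewrite sumr_const card_ord mulr_natl.
by rewrite !lp_normE lpnorm_rtrans.
Qed.

(** * Restriction to a subset and finite approximation *)

Fact restrict_subproof (A : set G) a :
  (fun x => if x \in A then a x else 0 : R[i]^o) \in @lp_pred R p G p1.
Proof.
apply/asboolP; apply: le_lt_trans (lp_fin a).
apply: le_esum => x _; rewrite lee_fin; case: ifP => // _.
by rewrite normc0 powR0 ?powR_ge0// gt_eqF// (lt_le_trans _ p1).
Qed.

Definition lp_restrict A a : Lp := MkLp (restrict_subproof A a).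

Let p0 : 0 < p. Proof. exact: lt_le_trans p1. Qed.

Lemma lpsum_restrict A a :
  lpsum p (lp_restrict A a) = \esum_(x in A) (normc (a x : R[i]) `^ p)%:E.
Proof.
rewrite esum_mkcond; apply: eq_esum => x _ /=.
by case: ifP => //; rewrite normc0 powR0 ?gt_eqF.
Qed.

(** The translate by [z ^+ k] is supported at the single point x z^k. These points are distinct, so
    each new term adds its full p-th power sum. *)
Lemma lpsum_orbit_sum z n x a : infinite_order z ->
  lpsum p (\sum_(k < n) rtrans (lp_restrict [set x] a) (z ^+ k)%g : Lp) =
  (n%:R%:E * lpsum p (lp_restrict [set x] a))%E.
Proof.
move=> zinf; set b := lp_restrict _ _.
have valS m y : (\sum_(k < m) rtrans b (z ^+ k)%g : Lp) y =
    \sum_(k < m) b (y * (z ^+ k)^-1)%g.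
  by elim: m => [|m IH]; rewrite ?big_ord0// !big_ord_recr/= -IH.
elim: n => [|n IH]; first by rewrite big_ord0 mul0e lpsum0.
rewrite big_ord_recr/= lpsumD_disjoint// ?IH; last first.
  move=> y; rewrite valS/= /rtranslate/=; case: ifPn => [|]; last by right.
  rewrite inE/= => yx; left; apply: big1 => k _; case: ifPn => //.
  rewrite inE/= -yx => /mulgI/invg_inj/(infinite_order_expg_inj zinf) kn.
  by have := ltn_ord k; rewrite kn ltnn.
rewrite lpsum_rtranslate -[in RHS]addn1 natrD EFinD ge0_muleDl ?lee_fin//.
by rewrite mul1e.
Qed.

(** As a supremum of finite sums, [lpsum p a] is reached up to [e] on some finite [A]. The remainder
    has support disjoint from [A], so its own sum is exactly what is missing. *)
Lemma finite_lpsum_approx a (e : R) : 0 < e ->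
  exists2 A, finite_set A & (lpsum p (a - lp_restrict A a : Lp)%R <= e%:E)%E.
Proof.
move=> e0; have afin : lpsum p a \is a fin_num.
  by rewrite ge0_fin_numE ?lpsum_ge0 ?lp_fin.
have [_ [A [finA _] <-]] := ub_ereal_sup_adherent e0 afin.
rewrite -[ereal_sup _]/(lpsum p a) -esum_fset//; last first.
  by move=> x _; rewrite lee_fin powR_ge0.
rewrite -lpsum_restrict => lt; exists A => //.
have := lpsumD_disjoint (a := a - lp_restrict A a : Lp) (b := lp_restrict A a) p0.
have -> : lp_val (a - lp_restrict A a) + lp_val (lp_restrict A a) = lp_val a.
  by apply/funext => x; exact: (subrK (lp_restrict A a x) (a x)).
move=> lpsum_split; rewrite lpsum_split in lt; last first.
  move=> x; rewrite -[(a - _) x]/(a x - lp_restrict A a x)/=.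
  by case: ifP => _; [left; rewrite subrr|right].
move: lt; have := lp_fin (lp_restrict A a); have := lp_fin (a - lp_restrict A a).
have := lpsum_ge0 p (lp_restrict A a); have := lpsum_ge0 p (a - lp_restrict A a : Lp).
case: (lpsum p (_ - _)) => // u _; case: (lpsum p _) => // v _ _ _.
rewrite -!EFinD lte_fin lee_fin addrAC gtrDr subr_lt0.
exact: ltW.
Qed.

(** With N = n + 1 and C the p-th power sum of the restriction, the bound to reach is N C <= (N
    e)^p, that is C / e^p <= N^(p-1), true for large N since [1 < p]. *)
Lemma ergodic_avg_point_cvg z x a : 1 < p -> infinite_order z ->
  ergodic_avg z n (lp_restrict [set x] a) @[n --> \oo] --> (0 : Lp).
Proof.
move=> hp zinf; apply: lp_cvg0P => e e0.
set b := lp_restrict _ _; set C := fine (lpsum p b).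
near=> n; rewrite /ergodic_avg.
set N : R := n.+1%:R; have N0 : 0 < N by rewrite ltr0n.
rewrite -[n.+1%:R](rmorph_nat (real_complex R)) -fmorphV/= lpnormZ//; last exact: lp_fin.
rewrite /= expr0n/= addr0 sqrtr_sqr ger0_norm ?invr_ge0 ?(ltW N0)//.
rewrite ler_pdivrMl//; apply: lpnorm_le => //; first by rewrite mulr_ge0// ltW.
rewrite lpsum_orbit_sum// -[lpsum p b]fineK; last first.
  by rewrite ge0_fin_numE ?lpsum_ge0 ?lp_fin.
rewrite -/C -EFinM lee_fin powRM ?(ltW e0) ?(ltW N0)//.
rewrite -(mulr_powRB1 (ltW N0) p0) -mulrA ler_pM2l//.
rewrite -ler_pdivrMr ?powR_gt0//.
have C0 : 0 <= C / e `^ p by rewrite divr_ge0 ?powR_ge0// fine_ge0 ?lpsum_ge0.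
have q0 : 0 < p - 1 by rewrite subr_gt0.
(* Written as a power of exponent [p - 1], the threshold becomes N >= (C / e^p)^(1/(p-1)). *)
have -> : C / e `^ p = ((C / e `^ p) `^ (p - 1)^-1) `^ (p - 1).
  by rewrite -powRrM mulVf ?gt_eqF// powRr1.
rewrite ge0_ler_powR ?(ltW q0) ?nnegrE ?powR_ge0 ?(ltW N0)//.
apply: (@le_trans _ _ n%:R); last by rewrite ler_nat.
by near: n; exact: nbhs_infty_ger.
Unshelve. all: by end_near. Qed.

Lemma ergodic_avg_restrict_cvg z A a : 1 < p -> infinite_order z ->
  finite_set A -> ergodic_avg z n (lp_restrict A a) @[n --> \oo] --> (0 : Lp).
Proof.
move=> hp zinf /finite_seqP[s ->].
elim: s => [|x s IH].
  have -> : lp_restrict [set` [::]] a = 0.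
    by apply/val_inj/funext => y /=; rewrite set_nil in_set0.
  by under eq_fun do rewrite ergodic_avg0; exact: cvg_cst.
(* A repeated entry leaves the set unchanged; splitting off [x] additively is valid only when [x] is
   new. *)
have [xs|xs] := boolP (x \in s).
  suff -> : [set` x :: s] = [set` s] by [].
  apply/seteqP; split => y /=; rewrite inE; last by move=> ->; rewrite orbT.
  by case/orP => // /eqP ->.
have -> : lp_restrict [set` x :: s] a = lp_restrict [set x] a + lp_restrict [set` s] a.
  apply/val_inj/funext => y /=; rewrite -[RHS]/(_ + _).
  rewrite !mem_setE in_cons; have [->|yx] := eqVneq y x.
    by rewrite mem_set// (negbTE xs) addr0.
  by rewrite [y \in [set x]]memNset ?add0r//=; exact/eqP.
under eq_fun do rewrite ergodic_avgD.
have := cvgD (ergodic_avg_point_cvg x a hp zinf) IH.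
by rewrite addr0; apply.
Qed.

Lemma mean_ergodic_cvg z a : 1 < p -> infinite_order z ->
  ergodic_avg z n a @[n --> \oo] --> (0 : Lp).
Proof.
move=> hp zinf; apply: lp_cvg0P => e e0.
have e20 : 0 < e / 2 by rewrite divr_gt0.
(* A tolerance of (e/2)^p on p-th power sums bounds the norm of the remainder by e/2, and averaging
   does not increase it. *)
have [A finA aA] := finite_lpsum_approx a (powR_gt0 p e20).
have /cvgr0Pnorm_le/(_ (e / 2)%:C%C) := ergodic_avg_restrict_cvg a hp zinf finA.
rewrite ltcR => /(_ e20) h; near=> n.
rewrite -lecR -[X in X <= _]lp_normE -(subrK (lp_restrict A a) a) ergodic_avgD.
apply: le_trans (ler_normD _ _) _; rewrite [e]splitr rmorphD lerD//; last first.
  by near: n; exact: h.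
apply: le_trans (norm_ergodic_avg _ _ _) _.
by rewrite lp_normE lecR; apply: lpnorm_le => //; exact: ltW.
Unshelve. all: by end_near. Qed.

(** * From averages to coboundaries *)

Lemma cocycle_central_power (d : cocycle p1 G) z (g : G) k : central z ->
  rtrans (d (z ^+ k)%g) g - d (z ^+ k)%g = rtrans (d g) (z ^+ k)%g - d g.
Proof.
move=> zc; have /(congr1 d) := commuteX k (esym (zc g)).
rewrite !cocycleP => E.
by apply/eqP; rewrite subr_eq addrAC E addrK.
Qed.

Lemma coboundary_orbit_sum (d : cocycle p1 G) z n (g : G) : central z ->
  coboundary (- (n.+1%:R^-1 *: \sum_(k < n.+1) d (z ^+ k)%g)) g =
  d g - ergodic_avg z n (d g).
Proof.
move=> zc; rewrite /= /ergodic_avg -scaleNr rtransZ -scalerBr rtrans_sum -sumrB.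
under eq_bigr do rewrite cocycle_central_power//.
(* The term [d g] occurs n + 1 times, so it averages to itself; the outer minus sign makes it
   positive. *)
rewrite sumrB sumr_const card_ord scalerBr !scaleNr opprK addrC; congr (_ - _).
by rewrite -[d g *+ _]scaler_nat scalerA mulVf ?scale1r// pnatr_eq0.
Qed.

Lemma cocycle_in_closure (d : cocycle p1 G) z : 1 < p ->
  central z -> infinite_order z -> closure (@coboundaries R p p1 G) d.
Proof.
move=> hp zc zinf U Ud.
pose a n : Lp := - (n.+1%:R^-1 *: \sum_(k < n.+1) d (z ^+ k)%g).
have acvg : coboundary (a n) @[n --> \oo] --> d.
  (* Convergence is tested at each [g], where the error is the average of [d g] up to sign. *)
  apply/cocycle_cvgE => g.
  suff : coboundary (a n) g @[n --> \oo] --> d g by [].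
  under eq_fun do rewrite /a coboundary_orbit_sum//.
  have := cvgB (cvg_cst (d g)) (mean_ergodic_cvg (d g) hp zinf).
  by rewrite subr0; apply.
have aU : \forall n \near \oo, U (coboundary (a n)) by exact: acvg.
have [n Un] := filter_ex aU.
by exists (coboundary (a n)); split => //; exists (a n).
Qed.

End mean_ergodic.

Unset Implicit Arguments.
Set Strict Implicit.

Theorem theorem5p3 (R : realType) (p : R) (hp : 1 < p) (G : groupType)
    (hfg : finitely_generated G)
    (hz : exists z : G, central z /\ infinite_order z) :
  forall c : reducedH1 (ltW hp) G, c = 0.
Proof.
have [z [zc zinf]] := hz.
(* A class is zero exactly when its representative, minus 0, lies in [closed_coboundaries]. *)
elim/quotW => d; apply/eqP; rewrite piE Quotient.equivE subr0; apply/asboolP.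
exact: cocycle_in_closure zc zinf.
Qed.
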